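(* Let $N=abN'$ be odd, with $a,b,N'$ positive integers and $\gcd(a,b)=1$. Let $K=\{0,a,\dots,(bN'-1)a\}$ and $L=\{0,b,\dots,(aN'-1)b\}$, viewed as subgroups of $\mathbb{Z}/N\mathbb{Z}$. Let $\varphi\in\mathbb{C}^N$ be a Wiener sequence of odd length $N$, and let $G$ be the Gram matrix of the Gabor system $(\varphi,K\times L)$. Then: (i) $\operatorname{rank}(G)=N$. (ii) Every nonzero eigenvalue of $G$ equals $NN'$. In particular, the Gabor system $(\varphi,K\times L)$ is a tight frame for $\mathbb{C}^N$ with frame bound $NN'$.
   Context: Vectors in $\mathbb{C}^N$ are indexed by $\mathbb{Z}/N\mathbb{Z}$, and $\langle x,y\rangle=\sum_j x[j]\overline{y[j]}$. Translation and modulation are $\tau_k(\varphi)[j]=\varphi[j-k]$ and $e_\ell(\varphi)[j]=e^{2\pi i j\ell/N}\varphi[j]$. The Gabor system is the family $(\varphi,K\times L)=\{e_\ell\tau_k\varphi:(k,\ell)\in K\times L\}$, indexed by $K\times L$. A finite family $\{v_i\}$ in $\mathbb{C}^N$ is a tight frame with frame bound $A>0$ if $\sum_i|\langle x,v_i\rangle|^2=A\|x\|_2^2$ for all $x\in\mathbb{C}^N$. The Gram matrix of a family $\{v_i\}$ has entries $G_{i,j}=\langle v_i,v_j\rangle$. A Wiener sequence of odd length $N$ is $\varphi[k]=e^{2\pi i s k^2/N}$, $k\in\mathbb{Z}/N\mathbb{Z}$, where $s$ is an integer with $\gcd(s,N)=1$. *)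

(* Defs.v *)
(* The complex field is R[i] for R : realType. *)
From HB Require Import structures.
From mathcomp Require Import all_boot all_order all_algebra.
From mathcomp Require Import reals trigo complex.

Set Implicit Arguments.
Unset Strict Implicit.
Unset Printing Implicit Defensive.

Import Order.TTheory GRing.Theory Num.Theory.
Local Open Scope ring_scope.
Local Open Scope complex_scope.

(* e^{2 pi i t} *)
Definition cis (R : realType) (t : R) : R[i] :=
  cos (2 * pi * t) +i* sin (2 * pi * t).

(* Z/NZ is 'I_n.+1 with N = n.+1 (an additive group for every n, whereas 'Z_1
   is Z/2Z), and C^N is 'rV[R[i]]_n.+1.  In translate, j - k is the subtraction
   of Z/NZ; in modulate and wiener, j, l and k are read as their
   representatives in {0, ..., N-1}. *)

Definition translate (R : realType) (n : nat) (k : 'I_n.+1)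
    (phi : 'rV[R[i]]_n.+1) : 'rV[R[i]]_n.+1 :=
  \row_(j < n.+1) phi 0 (j - k).

Definition modulate (R : realType) (n : nat) (l : 'I_n.+1)
    (phi : 'rV[R[i]]_n.+1) : 'rV[R[i]]_n.+1 :=
  \row_(j < n.+1) (cis ((j * l)%N%:R / n.+1%:R) * phi 0 j).

Definition gabor (R : realType) (n : nat) (phi : 'rV[R[i]]_n.+1)
    (K L : {set 'I_n.+1}) :
    {kl : 'I_n.+1 * 'I_n.+1 | kl \in setX K L} -> 'rV[R[i]]_n.+1 :=
  fun kl => modulate (val kl).2 (translate (val kl).1 phi).

(* {0, d, ..., (m - 1) d} in Z/NZ *)
Definition multiples (n d m : nat) : {set 'I_n.+1} :=
  [set inZp (i * d) | i : 'I_m].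

(* dotmx u v = \sum_j u 0 j * (v 0 j)^*, linear in the first argument *)
Definition gram (R : realType) (N : nat) (I : finType)
    (v : I -> 'rV[R[i]]_N) : 'M[R[i]]_#|{: I}| :=
  \matrix_(i, j) dotmx (v (enum_val i)) (v (enum_val j)).

Definition tight_frame (R : realType) (N : nat) (I : finType)
    (v : I -> 'rV[R[i]]_N) (A : R) : Prop :=
  0 < A /\
  forall x : 'rV[R[i]]_N,
    \sum_(i : I) `|dotmx x (v i)| ^+ 2 = A%:C * \sum_(j < N) `|x 0 j| ^+ 2.

Definition wiener (R : realType) (n : nat) (phi : 'rV[R[i]]_n.+1) : Prop :=
  exists s : int, coprimez s n.+1%:Z /\
    forall k : 'I_n.+1, phi 0 k = cis (s%:~R * k%:R ^+ 2 / n.+1%:R).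

(* Main.v *)
(* Let V be the matrix whose rows are the vectors of the Gabor system, so that
   G = V V^*. It suffices to show that the frame operator V^* V is N N' times
   the identity. With z = e^{2 pi i / N} and d = k - j, its (j, k) entry is a
   phase times
     (sum_{x in K} z^(-2 s d x)) (sum_{y in L} z^(d y)),
   two geometric sums, which vanish unless N divides 2 s d a and d b. As 2 and s
   are prime to N and gcd(a, b) = 1, this forces N | d. *)
Require Import Defs.
From HB Require Import structures.
From mathcomp Require Import all_boot all_order all_algebra.
From mathcomp Require Import reals trigo complex.
From mathcomp Require Import ring.

Set Implicit Arguments.
Unset Strict Implicit.
Unset Printing Implicit Defensive.

Import Order.TTheory GRing.Theory Num.Theory.
Local Open Scope ring_scope.
Local Open Scope complex_scope.

(** * Complex exponentials and roots of unity *)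

Section Cis.
Variable R : realType.
Implicit Types t u : R.

Lemma cis0 : cis 0 = 1 :> R[i].
Proof. by rewrite /cis mulr0 cos0 sin0. Qed.

Lemma cisD t u : cis (t + u) = cis t * cis u.
Proof.
by rewrite /cis mulrDr cosD sinD; simpc; rewrite [X in _ +i* X]addrC.
Qed.

Lemma cisN t : cis (- t) = (cis t)^-1.
Proof.
have h : cis t * cis (- t) = 1 by rewrite -cisD subrr cis0.
have t0 : cis t != 0.
  by apply: contra_eq_neq h => ->; rewrite mul0r eq_sym oner_eq0.
by apply: (mulfI t0); rewrite h divff.
Qed.

Lemma cis_conj t : Num.conj (cis t) = (cis t)^-1.
Proof. by rewrite -cisN /cis mulrN cosN sinN. Qed.

Lemma cisMn t (m : nat) : cis (t *+ m) = cis t ^+ m.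
Proof. by elim: m => [|m IH]; rewrite ?cis0 // mulrS exprS cisD IH. Qed.

Lemma cisMz t (m : int) : cis (t *~ m) = cis t ^ m.
Proof.
case: m => m; first exact: cisMn.
by rewrite NegzE mulrNz cisN -exprnN -cisMn.
Qed.

Lemma cis1 : cis 1 = 1 :> R[i].
Proof. by rewrite /cis mulr1 mulr_natl cos2pi sin2pi. Qed.

(** Half angles: real part 1 would force [cos (pi * t) ^+ 2 = 1], hence a zero sine, while [sin] is
    positive on the open interval from 0 to [pi]. *)
Lemma cis_neq1 t : 0 < t < 1 -> cis t != 1.
Proof.
move=> /andP[t0 t1]; apply/eqP => -[h _].
have : cos (pi * t) ^+ 2 = 1.
  move: h; rewrite -mulrA mulr_natl cos_mulr2n => /(canRL (subrK _)) h.
  by apply: (@pmulrnI _ 2) => //; rewrite h.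
have : 0 < sin (pi * t).
  by rewrite sin_gt0_pi// mulr_gt0 ?pi_gt0//= gtr_pMr ?pi_gt0.
have := cos2Dsin2 (pi * t) => <-.
by move=> s0 /eqP; rewrite -subr_eq0 opprD addNKr oppr_eq0 sqrf_eq0 gt_eqF.
Qed.

Lemma cis_prim_root (n : nat) : n.+1.-primitive_root (cis (n.+1%:R^-1 : R)).
Proof.
apply/andP; split=> //; apply/forallP => m; apply/eqP.
rewrite unity_rootE -cisMn -[_ *+ _]mulr_natl.
rewrite eqSS; have [-> |neq] := eqVneq (val m) n.
  by rewrite divff ?pnatr_eq0// cis1 eqxx.
have mn : (m < n)%N by rewrite ltn_neqAle neq -ltnS ltn_ord.
apply/negbTE/cis_neq1.
by rewrite divr_gt0 ?ltr0n//= ltr_pdivrMr ?ltr0n// mul1r ltr_nat ltnS.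
Qed.

End Cis.

Lemma prim_root_neq0 (F : fieldType) (N : nat) (z : F) :
  N.-primitive_root z -> z != 0.
Proof.
move=> zP; apply/eqP => z0; have /eqP := prim_expr_order zP.
by rewrite z0 expr0n gtn_eqF ?(prim_order_gt0 zP)// eq_sym oner_eq0.
Qed.

Lemma prim_rootXz (F : fieldType) (N : nat) (z : F) (m : int) :
  N.-primitive_root z -> (z ^ m == 1) = (N%:Z %| m)%Z.
Proof.
move=> zP; case: m => m; first by rewrite dvdzE/= (prim_order_dvd zP).
by rewrite (_ : z ^ Negz m = (z ^+ m.+1)^-1)// invr_eq1 -(prim_order_dvd zP).
Qed.

Lemma prim_rootXz_eqmod (F : fieldType) (N : nat) (z : F) (m p : int) :
  N.-primitive_root z -> (m = p %[mod N])%Z -> z ^ m = z ^ p.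
Proof.
move=> zP /eqP; rewrite eqz_mod_dvd -(prim_rootXz _ zP) => /eqP h.
have z0 := prim_root_neq0 zP.
by rewrite -(subrK p m) expfzDr// h mul1r.
Qed.

Lemma sum_unity_root_expr (F : fieldType) (M : nat) (w : F) :
  w ^+ M = 1 -> \sum_(i < M) w ^+ i = if w == 1 then M%:R else 0.
Proof.
move=> wM; have [-> |w1] := eqVneq w 1.
  by under eq_bigr do rewrite expr1n; rewrite sumr_const card_ord.
by apply: (mulfI (_ : w - 1 != 0)); rewrite ?subr_eq0// -subrX1 wM subrr mulr0.
Qed.

(** * Families whose frame operator is a scalar matrix *)

Section DualTight.
Variables (R : realType) (N : nat) (I : finType) (v : I -> 'rV[R[i]]_N).
Variable c : R[i].
Hypothesis c0 : c != 0.
Hypothesis frame_op : forall j k,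
  \sum_i Num.conj (v i 0 j) * v i 0 k = c *+ (j == k).

Let V : 'M[R[i]]_(#|{: I}|, N) := \matrix_(i, j) v (enum_val i) 0 j.
Let W : 'M[R[i]]_(N, #|{: I}|) := \matrix_(j, i) Num.conj (v (enum_val i) 0 j).

Let WV : W *m V = c%:M.
Proof.
apply/matrixP => j k; rewrite !mxE -frame_op.
rewrite (reindex (@enum_val I I)) /=; last exact: onW_bij (enum_val_bij _).
by apply: eq_bigr => i _; rewrite !mxE.
Qed.

Let dotmxW (x : 'rV[R[i]]_N) i : dotmx x (v (enum_val i)) = (x *m W) 0 i.
Proof. by rewrite dotmxE !mxE; apply: eq_bigr => j _; rewrite !mxE. Qed.

Let gramE : gram v = V *m W.
Proof.
apply/matrixP => i j; rewrite !mxE dotmxW !mxE.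
by apply: eq_bigr => k _; rewrite !mxE.
Qed.

(** The factorization [V *m W] through dimension [N] bounds the rank above. Below,
    [W *m gram v *m V] is [(W *m V) ^ 2], the scalar [c * c], of full rank, and multiplying cannot
    raise the rank. *)
Lemma rank_gram_tight : \rank (gram v) = N.
Proof.
apply/eqP; rewrite eqn_leq; apply/andP; split.
  by rewrite gramE (leq_trans (mxrankM_maxl _ _)) ?rank_leq_col.
have e : W *m gram v *m V = (c * c)%:M.
  by rewrite gramE mulmxA WV -mulmxA WV -scalar_mxM.
have r : \rank ((c * c)%:M : 'M[R[i]]_N) = N.
  by rewrite -scalemx1 mxrank_scale_nz ?mxrank1// mulf_neq0.
by rewrite -{1}r -e (leq_trans (mxrankM_maxl _ _)) ?mxrankM_maxr.
Qed.

(** Since [W *m V] is the scalar [c], the Gram matrix satisfies G^2 = c G, so an eigenvalue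
    satisfies [lam * lam = lam * c]. *)
Lemma eigenvalue_gram_tight (lam : R[i]) :
  eigenvalue (gram v) lam -> lam != 0 -> lam = c.
Proof.
move=> /eigenvalueP[u uG u0] lam0.
have GG : gram v *m gram v = c *: gram v.
  by rewrite gramE mulmxA -(mulmxA V) WV mul_mx_scalar scalemxAl.
have /eqP : (lam * lam - lam * c) *: u = 0.
  rewrite scalerBl; apply/eqP; rewrite subr_eq0; apply/eqP.
  rewrite -!scalerA -uG scalemxAl -uG -mulmxA GG.
  by rewrite -scalemxAr uG scalerA mulrC -scalerA.
by rewrite scaler_eq0 (negPf u0) orbF -mulrBr mulf_eq0 (negPf lam0)/= subr_eq0
  => /eqP.
Qed.

Lemma sum_sqr_dotmx_tight (x : 'rV[R[i]]_N) :
  \sum_i `|dotmx x (v i)| ^+ 2 = c * \sum_j `|x 0 j| ^+ 2.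
Proof.
(* The row [x *m W] lists the coefficients of [x], and [V *m (map_mx Num.conj x)^T] lists their
   conjugates. *)
transitivity ((x *m W *m V *m (map_mx Num.conj x)^T) 0 0).
  rewrite -!mulmxA (mulmxA x) mxE.
  rewrite (reindex (@enum_val I I)) /=; last exact: onW_bij (enum_val_bij _).
  apply: eq_bigr => i _; rewrite normCK dotmxW; congr (_ * _).
  rewrite !mxE rmorph_sum; apply: eq_bigr => j _.
  by rewrite !mxE rmorphM/= conjCK mulrC.
rewrite -(mulmxA x) WV mul_mx_scalar -scalemxAl !mxE; congr (_ * _).
by apply: eq_bigr => j _; rewrite !mxE normCK.
Qed.

End DualTight.

(** * Character sums over subgroups *)

Lemma big_multiples (T : nmodType) (n d m : nat) (F : 'I_n.+1 -> T) :
  (0 < d)%N -> n.+1 = (d * m)%N ->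
  \sum_(k in multiples n d m) F k = \sum_(i < m) F (inZp (i * d)).
Proof.
move=> d0 hN; rewrite big_imset//= => i j _ _ /(congr1 val)/=.
rewrite !modn_small; first by move/eqP; rewrite eqn_pmul2r// => /eqP/val_inj.
all: by rewrite hN mulnC ltn_pmul2l.
Qed.

(** A geometric sum of ratio [z ^ (e * d)], an [m]-th root of unity because [d * m] is the order of
    [z]. *)
Lemma sum_multiples_expz (F : fieldType) (n d m : nat) (z : F) (e : int) :
  n.+1.-primitive_root z -> (0 < d)%N -> n.+1 = (d * m)%N ->
  \sum_(k in multiples n d m) z ^ (e * (k : nat)%:Z) =
    if (n.+1%:Z %| e * d%:Z)%Z then m%:R else 0.
Proof.
move=> zP d0 hN; rewrite (big_multiples _ d0 hN) -(prim_rootXz _ zP).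
rewrite -sum_unity_root_expr; last first.
  apply/eqP; rewrite exprnP exprz_exp -mulrA -PoszM -hN (prim_rootXz _ zP).
  exact: dvdz_mull.
apply: eq_bigr => i _ /=; rewrite exprnP exprz_exp -mulrA -PoszM mulnC.
by rewrite modn_small// hN ltn_pmul2l.
Qed.

Lemma ordB_eqmod (n : nat) (j k : 'I_n.+1) :
  ((nat_of_ord (j - k))%:Z = j%:Z - k%:Z %[mod n.+1])%Z.
Proof.
apply/eqP; rewrite eqz_mod_dvd opprB addrA -PoszD -eqz_mod_dvd.
have h : (((j - k)%R + k) %% n.+1)%N = j := congr1 val (subrK k j).
by rewrite !modz_nat h modn_small.
Qed.

(** * The frame operator of the Wiener Gabor system *)

Section WienerGabor.
Variables (R : realType) (n : nat) (s : int) (phi : 'rV[R[i]]_n.+1).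
Hypothesis phiE :
  forall k : 'I_n.+1, phi 0 k = cis (s%:~R * k%:R ^+ 2 / n.+1%:R).

Let z : R[i] := cis n.+1%:R^-1.
Let zP : n.+1.-primitive_root z := cis_prim_root R n.

(** With each entry a single integer power of [z], conjugates and products become exponent
    arithmetic. Replacing the representative of [j - k] by the integer difference is harmless
    because [z] has order [n.+1]. *)
Lemma gabor_wienerE (K L : {set 'I_n.+1}) kl (j : 'I_n.+1) :
  gabor phi (K:=K) (L:=L) kl 0 j =
    z ^ (j%:Z * (val kl).2%:Z + s * (j%:Z - (val kl).1%:Z) ^+ 2).
Proof.
have z0 := prim_root_neq0 zP.
rewrite !mxE phiE expfzDr//; congr (_ * _).
  by rewrite -PoszM -exprnP -cisMn mulr_natl.
pose m : int := s * (nat_of_ord (j - (val kl).1))%:Z ^+ 2.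
rewrite -(prim_rootXz_eqmod zP (m := m)).
  by rewrite -cisMz -[_^-1 *~ _]mulrzl intrM rmorphXn.
by rewrite /m -modzMmr -modzXm ordB_eqmod modzXm modzMmr.
Qed.

Lemma gabor_wiener_frame_op (a b N' : nat) (j k : 'I_n.+1) :
    (0 < a)%N -> (0 < b)%N -> n.+1 = (a * b * N')%N -> odd n.+1 ->
    coprime a b -> coprimez s n.+1%:Z ->
  let K := multiples n a (b * N') in let L := multiples n b (a * N') in
  \sum_i Num.conj (gabor phi (K:=K) (L:=L) i 0 j) * gabor phi i 0 k
    = (n.+1 * N')%N%:R *+ (j == k).
Proof.
move=> a0 b0 hN oddN cab cs K L.
have z0 := prim_root_neq0 zP.
have zJ m : Num.conj (z ^ m) = z ^ (- m).
  by rewrite fmorphXz/= cis_conj exprz_inv.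
pose d := k%:Z - j%:Z.
(* The difference of squares (k - x)^2 - (j - x)^2 = d (k + j) - 2 d x separates a constant phase, a
   factor in x and a factor in y, so the double sum splits. *)
pose F (kl : 'I_n.+1 * 'I_n.+1) : R[i] := z ^ (s * d * (k%:Z + j%:Z)) *
  (z ^ (- (2 * s * d) * kl.1%:Z) * z ^ (d * kl.2%:Z)).
transitivity (\sum_(kl in setX K L) F kl).
  rewrite [RHS]big_sub; apply: eq_bigr => kl _.
  rewrite !gabor_wienerE zJ /F -!expfzDr//; congr (z ^ _).
  by rewrite /d; ring.
rewrite (eq_bigl (fun kl => (kl.1 \in K) && (kl.2 \in L))); last first.
  by case=> x y; rewrite inE.
rewrite -(pair_big (mem K) (mem L) (fun x y => F (x, y)))/=.
rewrite /F/=; under eq_bigr do rewrite -big_distrr -big_distrr/=.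
rewrite -big_distrr -big_distrl/=.
rewrite !(sum_multiples_expz _ zP)//; [|by rewrite hN; ring|by rewrite hN; ring].
(* Both 2 (by oddness) and [s] are prime to [n.+1] and cancel; the sign is immaterial. *)
have -> : (n.+1%:Z %| - (2 * s * d) * a%:Z)%Z = (n.+1%:Z %| d * a%:Z)%Z.
  have -> : - (2 * s * d) * a%:Z = 2 * (s * - (d * a%:Z)) by ring.
  rewrite (Gauss_dvdzr (n := 2)); last by rewrite coprimezE coprimen2.
  by rewrite (Gauss_dvdzr (n := s)) 1?coprimez_sym// !dvdzE abszN.
have [jk | jk] := eqVneq j k.
  (* On the diagonal [d] is 0, so the sums are the sizes [b * N'] and [a * N'], with product
     [n.+1 * N']. *)
  rewrite /d -jk subrr !mulr0 !mul0r dvdz0 expr0z mul1r -natrM hN mulr1n.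
  by congr _%:R; ring.
rewrite mulr0n; case: ifP => [da|_]; last by rewrite mul0r mulr0.
case: ifP => [db|_]; last by rewrite !mulr0.
(* Representatives below [n.+1] that are congruent are equal, against [jk]. *)
suff : (n.+1%:Z %| d)%Z.
  rewrite -eqz_mod_dvd !modz_nat eqz_nat !modn_small// eq_sym.
  by rewrite (negPf jk : (j == k :> nat) = false).
(* This gcd is the absolute value of [d], by coprimality of [a] and [b]. *)
have : (n.+1%:Z %| gcdz (d * a%:Z) (d * b%:Z))%Z by rewrite dvdz_gcd da db.
by rewrite -mulz_gcdr /gcdz/= (eqP cab) mulr1 dvdzE.
Qed.

End WienerGabor.

Theorem theorem7p10 (R : realType) (n a b N' : nat)
    (ha : (0 < a)%N) (hb : (0 < b)%N) (hN' : (0 < N')%N)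
    (hN : n.+1 = (a * b * N')%N) (hodd : odd n.+1) (hab : coprime a b)
    (phi : 'rV[R[i]]_n.+1) (hphi : wiener phi) :
  let K : {set 'I_n.+1} := multiples n a (b * N') in
  let L : {set 'I_n.+1} := multiples n b (a * N') in
  let G := gram (gabor phi (K:=K) (L:=L)) in
  [/\ \rank G = n.+1,
      forall lam : R[i], eigenvalue G lam -> lam != 0 ->
        lam = (n.+1 * N')%N%:R
    & tight_frame (gabor phi (K:=K) (L:=L)) (n.+1 * N')%N%:R].
Proof.
move=> K L G.
have c0 : (n.+1 * N')%N%:R != 0 :> R[i] by rewrite pnatr_eq0 muln_eq0/= -lt0n.
have op j k : \sum_i Num.conj (gabor phi (K:=K) (L:=L) i 0 j)
    * gabor phi (K:=K) (L:=L) i 0 k = (n.+1 * N')%N%:R *+ (j == k).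
  by case: hphi => s [cs phiE]; apply: (gabor_wiener_frame_op phiE).
split; first exact: rank_gram_tight c0 op.
  by move=> lam; apply: eigenvalue_gram_tight op _.
split; first by rewrite ltr0n muln_gt0.
by move=> x; rewrite (sum_sqr_dotmx_tight op) rmorph_nat.
Qed.
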